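(* Let $\Phi\colon \mathbb{R}^+\times\mathbb{R}^+\to\mathbb{R}^+$ be a triangle function satisfying the standing conditions (1)–(3) listed in the context and continuous in both variables, and let $(G,w)$ be a weighted graph with a $\Phi$-pseudosemimetrizable weight $w$. If $G$ is a connected graph, then $d_{\Phi}^{w}$ is the greatest element of the partially ordered set $(\mathfrak{M}_{\Phi}^{w},\preceq)$. Conversely, if $(\mathfrak{M}_{\Phi}^{w},\preceq)$ has a greatest element, then $G$ is a connected graph.
   Context: $\mathbb{R}^+=[0,\infty)$. A graph $G=(V(G),E(G))$ is simple and may be finite or infinite, with $V(G)\neq\varnothing$; edges are two-element subsets of $V(G)$; paths and cycles are finite and simple. A graph is connected if any two distinct vertices can be joined by a path. A weighted graph $(G,w)$ is a graph $G$ together with a function $w\colon E(G)\to\mathbb{R}^+$. A pseudosemimetric on a nonempty set $X$ is a function $d\colon X\times X\to\mathbb{R}^+$ with $d(x,x)=0$ and $d(x,y)=d(y,x)$ for all $x,y\in X$. A triangle function is a function $\Phi\colon\mathbb{R}^+\times\mathbb{R}^+\to\mathbb{R}^+$ that is symmetric ($\Phi(x,y)=\Phi(y,x)$), monotone increasing (in the non-strict sense) in each argument, and satisfies $\Phi(0,0)=0$. A pseudosemimetric $d$ on $X$ is a $\Phi$-pseudosemimetric if $d(x,y)\leqslant\Phi(d(x,z),d(y,z))$ for all $x,y,z\in X$. For nonnegative reals put $\Phi^*(x_1)=x_1$, $\Phi^*(x_1,x_2)=\Phi(x_1,x_2)$, and $\Phi^*(x_1,\dots,x_n)=\Phi(x_1,\Phi^*(x_2,\dots,x_n))$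 for $n\geqslant 3$. Standing conditions on $\Phi$: (1) $\Phi(x,\Phi(y,z))=\Phi(z,\Phi(x,y))$ for all $x,y,z\in\mathbb{R}^+$; (2) $\Phi^*(a_1,\dots,a_n)\leqslant\Phi(\Phi^*(b_1,\dots,b_p),\Phi^*(c_1,\dots,c_q))$ whenever $n,p,q\geqslant1$ and $A=[a_1,\dots,a_n]$, $B=[b_1,\dots,b_p]$, $C=[c_1,\dots,c_q]$ are multisets of nonnegative reals with $A\subseteq B\cup C$, where $B\cup C$ denotes the multiset $[b_1,\dots,b_p,c_1,\dots,c_q]$ (multiplicities are added) and inclusion is multiset inclusion; (3) $\Phi(a,b)\geqslant\max\{a,b\}$ for all $a,b\in\mathbb{R}^+$. For a path $P$ in $G$, its $\Phi$-weight is $w_\Phi(P)=0$ if $E(P)=\varnothing$, and $w_\Phi(P)=\Phi^*(w(e_1),\dots,w(e_n))$ otherwise, where $e_1,\dots,e_n$ are all the edges of $P$ (since $\Phi$ is symmetric and satisfies $\Phi(x,\Phi(y,z))=\Phi(z,\Phi(x,y))$ for all $x,y,z\in\mathbb{R}^+$, the value does not depend on the order of the edges). For $u,v$ in the same connected component of $G$, $d_\Phi^w(u,v)=\inf\{w_\Phi(P)\colon P\in\mathcal{P}_{u,v}\}$, where $\mathcal{P}_{u,v}$ is the set of all paths in $G$ joining $u$ and $v$ (for $u=v$ this includes the path with no edges). The weight $w$ is $\Phi$-pseudosemimetrizable if there is a $\Phi$-pseudosemimetric $d$ on $V(G)$ with $w(\{u,v\})=d(u,v)$ for all $\{u,v\}\in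 E(G)$; $\mathfrak{M}_\Phi^w$ denotes the set of all such $d$. The partial order is: $d_1\preceq d_2$ iff $d_1(x,y)\leqslant d_2(x,y)$ for all $x,y\in V(G)$. *)

(* Defs.v *)
From HB Require Import structures.
From mathcomp Require Import all_boot all_order all_algebra.
From mathcomp Require Import all_classical all_reals all_analysis.
Import Order.TTheory GRing.Theory Num.Theory.
Import numFieldNormedType.Exports.

Set Implicit Arguments.
Unset Strict Implicit.
Unset Printing Implicit Defensive.

Local Open Scope classical_set_scope.
Local Open Scope ring_scope.

(* Functions on [0, +oo[ are represented by functions on R of which only the
   values at nonnegative arguments are ever constrained or used. *)

Record triangle_function (R : realType) (Phi : R -> R -> R) : Prop := {
  triangle_ge0 : forall x y, 0 <= x -> 0 <= y -> 0 <= Phi x y ;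
  triangle_sym : forall x y, 0 <= x -> 0 <= y -> Phi x y = Phi y x ;
  triangle_monol : forall x x' y,
    0 <= x -> x <= x' -> 0 <= y -> Phi x y <= Phi x' y ;
  triangle_monor : forall x y y',
    0 <= x -> 0 <= y -> y <= y' -> Phi x y <= Phi x y' ;
  triangle_00 : Phi 0 0 = 0
}.

Definition continuous_nneg2 (R : realType) (Phi : R -> R -> R) : Prop :=
  {within [set p : R * R | 0 <= p.1 /\ 0 <= p.2],
    continuous (fun p : R * R => Phi p.1 p.2)}.

(* The value 0 on the empty sequence is the convention for the weight of a
   path without edges. *)
Fixpoint phistar (R : realType) (Phi : R -> R -> R) (s : seq R) : R :=
  match s with
  | [::] => 0
  | [:: x] => x
  | x :: s' => Phi x (phistar Phi s')
  end.

Definition cyclic_assoc (R : realType) (Phi : R -> R -> R) : Prop :=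
  forall x y z, 0 <= x -> 0 <= y -> 0 <= z ->
    Phi x (Phi y z) = Phi z (Phi x y).

(* Multisets are represented by sequences; the order of the terms does not
   matter to [phistar] when Phi is symmetric and satisfies [cyclic_assoc]. *)
Definition multiset_subadditive (R : realType) (Phi : R -> R -> R) : Prop :=
  forall a b c : seq R,
    a != [::] -> b != [::] -> c != [::] ->
    {in a, forall x, 0 <= x} -> {in b, forall x, 0 <= x} ->
    {in c, forall x, 0 <= x} ->
    (forall x, (count_mem x a <= count_mem x (b ++ c))%N) ->
    phistar Phi a <= Phi (phistar Phi b) (phistar Phi c).

Definition dominates_max (R : realType) (Phi : R -> R -> R) : Prop :=
  forall a b, 0 <= a -> 0 <= b -> Num.max a b <= Phi a b.

Structure graph := Graph {
  vertex : eqType ;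
  edge : set (set vertex) ;
  vertex_nonempty : [set: vertex] !=set0 ;
  edge_pair : forall e, edge e -> exists x y, x != y /\ e = [set x; y]
}.

Definition adjacent (G : graph) : rel (vertex G) :=
  fun x y => `[< edge [set x; y] >].

(* A path from u to v is given by the sequence p of its vertices after u. *)
Definition paths (G : graph) (u v : vertex G) : set (seq (vertex G)) :=
  [set p | [/\ path (@adjacent G) u p, uniq (u :: p) & last u p = v]].

Definition graph_connected (G : graph) : Prop :=
  forall u v : vertex G, u != v -> paths u v !=set0.

(* A weight is a function on all sets of vertices of which only the values on
   edges matter. *)
Definition is_weight (R : realType) (G : graph) (w : set (vertex G) -> R) :
  Prop := forall e, edge e -> 0 <= w e.

Definition path_weight (R : realType) (Phi : R -> R -> R) (G : graph)
    (w : set (vertex G) -> R) (u : vertex G) (p : seq (vertex G)) : R :=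
  phistar Phi (pairmap (fun x y => w [set x; y]) u p).

(* Meaningful for u and v in the same connected component; [inf] is then the
   infimum of a nonempty set of nonnegative reals. *)
Definition dPhi (R : realType) (Phi : R -> R -> R) (G : graph)
    (w : set (vertex G) -> R) (u v : vertex G) : R :=
  inf [set path_weight Phi w u p | p in paths u v].

Record pseudosemimetric (R : realType) (X : Type) (d : X -> X -> R) : Prop := {
  psm_ge0 : forall x y, 0 <= d x y ;
  psm_refl : forall x, d x x = 0 ;
  psm_sym : forall x y, d x y = d y x
}.

Definition Phi_pseudosemimetric (R : realType) (Phi : R -> R -> R) (X : Type)
    (d : X -> X -> R) : Prop :=
  pseudosemimetric d /\ forall x y z, d x y <= Phi (d x z) (d y z).

Definition metrizations (R : realType) (Phi : R -> R -> R) (G : graph)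
    (w : set (vertex G) -> R) : set (vertex G -> vertex G -> R) :=
  [set d | Phi_pseudosemimetric Phi d /\
           forall u v, edge [set u; v] -> w [set u; v] = d u v].

Definition pseudosemimetrizable (R : realType) (Phi : R -> R -> R) (G : graph)
    (w : set (vertex G) -> R) : Prop :=
  exists d, metrizations Phi w d.

Definition psm_le (R : realType) (X : Type) (d1 d2 : X -> X -> R) : Prop :=
  forall x y, d1 x y <= d2 x y.

Definition is_greatest (R : realType) (X : Type) (M : set (X -> X -> R))
    (d : X -> X -> R) : Prop :=
  M d /\ forall d', M d' -> psm_le d' d.

(* Main.v *)
Require Import Defs.
From HB Require Import structures.
From mathcomp Require Import all_boot all_order all_algebra.
From mathcomp Require Import all_classical all_reals all_analysis.
Import Order.TTheory GRing.Theory Num.Theory.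
Import numFieldNormedType.Exports.
Local Open Scope classical_set_scope.
Local Open Scope ring_scope.

(** For every metrization d of the weight, iterating the Phi-triangle
    inequality along a walk bounds the distance of its ends by the Phi-weight
    of the walk ([metrization_le_walk]); hence every metrization lies below
    the infimum dPhi, and since some metrization exists, dPhi agrees with w on
    edges. That dPhi is itself a metrization rests on loop erasure: from a
    path from x to z and a path from y to z one obtains a path from x to y
    whose multiset of weights is contained in the union of the two given ones
    ([path_join]), so its weight is at most the Phi-sum of the two weights.
    Continuity of Phi then lets both paths tend to their infima
    ([Phi_inf_ge]).

    Conversely, if u and v are not joined by a path, let C be the component of
    u. Any metrization d may be kept inside C and inside its complement while
    the two sides are linked only by a virtual edge of arbitrary length k from
    u to v: the result is again a metrization
    ([Phi_pseudosemimetric_bridge]), and it puts u and v at distance at least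
    k. So distances between u and v are unbounded over all metrizations, and
    no greatest one exists. *)

(** * Iterating a triangle function over a multiset *)

Section TriangleFunction.
Context {R : realType} {Phi : R -> R -> R}.
Hypothesis hPhi : triangle_function Phi.

Lemma triangle_mono x x' y y' : 0 <= x -> 0 <= y -> x <= x' -> y <= y' ->
  Phi x y <= Phi x' y'.
Proof.
move=> x0 y0 xx' yy'; apply: (le_trans (triangle_monol hPhi _ xx' _)) => //.
by apply: (triangle_monor hPhi) => //; exact: le_trans xx'.
Qed.

Lemma phistar_cons x s : s != [::] ->
  phistar Phi (x :: s) = Phi x (phistar Phi s).
Proof. by case: s. Qed.

Lemma phistar_ge0 s : {in s, forall x, 0 <= x} -> 0 <= phistar Phi s.
Proof.
elim: s => [//|x s IHs] s_ge0.
have x_ge0 : 0 <= x by apply: s_ge0; rewrite mem_head.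
have [->//|sN] := eqVneq s [::].
rewrite phistar_cons//; apply: (triangle_ge0 hPhi) => //; apply: IHs => y ys.
by apply: s_ge0; rewrite in_cons ys orbT.
Qed.

Lemma Phi_assoc : cyclic_assoc Phi ->
  forall x y z, 0 <= x -> 0 <= y -> 0 <= z -> Phi x (Phi y z) = Phi (Phi x y) z.
Proof.
move=> cycPhi x y z x0 y0 z0; rewrite cycPhi// (triangle_sym hPhi)//.
exact: (triangle_ge0 hPhi).
Qed.

Lemma le_Phil : dominates_max Phi ->
  forall x y, 0 <= x -> 0 <= y -> x <= Phi x y.
Proof.
by move=> domPhi x y x0 y0; apply: le_trans (domPhi _ _ x0 y0); rewrite le_max lexx.
Qed.

Lemma le_Phir : dominates_max Phi ->
  forall x y, 0 <= x -> 0 <= y -> y <= Phi x y.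
Proof.
by move=> domPhi x y x0 y0; apply: le_trans (domPhi _ _ x0 y0);
  rewrite le_max lexx orbT.
Qed.

(** A sequence with at least two terms splits into its head and its tail, and
    Phi of the two parts is its own iterate; so subadditivity compares it with
    any rearrangement, in both directions. *)
Lemma phistar_perm : multiset_subadditive Phi ->
  forall s t, {in s, forall x, 0 <= x} -> perm_eq s t ->
  phistar Phi s = phistar Phi t.
Proof.
move=> subPhi.
have le_perm s t : {in s, forall x, 0 <= x} -> perm_eq s t ->
    phistar Phi s <= phistar Phi t.
  move=> s_ge0 st; have memst := perm_mem st.
  case: t => [|x [|y t]] in st memst *.
  - by rewrite (perm_nilP st).
  - by rewrite (perm_small_eq _ st).
  - rewrite phistar_cons//; apply: (subPhi s [:: x]) => //.
    + by apply: contraTneq st => ->; apply/negP => /perm_size.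
    + by move=> z; rewrite inE => /eqP->; apply: s_ge0; rewrite memst mem_head.
    + by move=> z zt; apply: s_ge0; rewrite memst in_cons zt orbT.
    + by move=> z; rewrite (permP st).
move=> s t s_ge0 st; apply/eqP; rewrite eq_le le_perm//= le_perm//.
  by move=> x; rewrite -(perm_mem st); exact: s_ge0.
by rewrite perm_sym.
Qed.

(** Adjoining the term 0 to an empty multiset makes it nonempty without changing
    its iterate, which is 0 by convention. *)
Lemma phistar_subadd : multiset_subadditive Phi -> forall a b c,
  {in a, forall x, 0 <= x} -> {in b, forall x, 0 <= x} ->
  {in c, forall x, 0 <= x} ->
  (forall x, (count_mem x a <= count_mem x (b ++ c))%N) ->
  phistar Phi a <= Phi (phistar Phi b) (phistar Phi c).
Proof.
move=> subPhi a b c a_ge0 b_ge0 c_ge0 abc.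
have [->|aN] := eqVneq a [::].
  by apply: (triangle_ge0 hPhi); apply: phistar_ge0.
have nonempty s : {in s, forall x, 0 <= x} -> exists t,
    [/\ t != [::], {in t, forall x, 0 <= x}, phistar Phi t = phistar Phi s
      & forall x, (count_mem x s <= count_mem x t)%N].
  move=> s_ge0; have [->|sN] := eqVneq s [::]; last by exists s.
  by exists [:: 0]; split=> // x; rewrite inE => /eqP->.
have [b' [b'N b'_ge0 <- bb']] := nonempty b b_ge0.
have [c' [c'N c'_ge0 <- cc']] := nonempty c c_ge0.
apply: subPhi => // x; apply: leq_trans (abc x) _.
by rewrite !count_cat leq_add.
Qed.

(** A strict violation at the infima would persist, by continuity, at nearby
    members of the two sets. *)
Lemma Phi_inf_ge : continuous_nneg2 Phi ->
  forall (A B : set R) m, A !=set0 -> B !=set0 ->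
  lbound A 0 -> lbound B 0 ->
  (forall a b, A a -> B b -> m <= Phi a b) -> m <= Phi (inf A) (inf B).
Proof.
move=> contPhi A B m A0 B0 A_ge0 B_ge0 le_m.
have infA_ge0 : 0 <= inf A by apply: lb_le_inf.
have infB_ge0 : 0 <= inf B by apply: lb_le_inf.
rewrite leNgt; apply/negP => lt_m.
have /subspace_continuousP/(_ (inf A, inf B) (conj infA_ge0 infB_ge0)) := contPhi.
move=> /cvgr_lt/(_ m lt_m)/=; rewrite /prop_near1/= => /nbhs_ballP[e /= e0 near_m].
have near_inf C : C !=set0 -> lbound C 0 ->
    exists2 c, C c & ball (inf C) e c.
  move=> C0 C_ge0; have infC : has_inf C by split=> //; exists 0.
  have [c Cc ltc] := inf_adherent e0 infC; exists c => //.
  rewrite /ball/= distrC ger0_norm ?ltrBlDl//.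
  by rewrite subr_ge0; apply: ge_inf => //; exists 0.
have [a Aa ball_a] := near_inf A A0 A_ge0.
have [b Bb ball_b] := near_inf B B0 B_ge0.
have /(_ (conj (A_ge0 _ Aa) (B_ge0 _ Bb)))/= := near_m (a, b) (conj ball_a ball_b).
by rewrite ltNge le_m.
Qed.

End TriangleFunction.

(** * Walks, reversal and loop erasure *)

Section Walks.
Context {T : eqType}.

Lemma last_rev_belast (x : T) p : last (last x p) (rev (belast x p)) = x.
Proof. by case: p => //= y p; rewrite rev_cons last_rcons. Qed.

Lemma pairmap_rev {S : Type} (f : T -> T -> S) (x : T) p :
  (forall y z, f y z = f z y) ->
  pairmap f (last x p) (rev (belast x p)) = rev (pairmap f x p).
Proof.
move=> f_sym; elim: p x => [//|y p IHp] x /=.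
rewrite !rev_cons -!cats1 pairmap_cat IHp last_rev_belast /=.
by rewrite f_sym.
Qed.

(** Loop erasure of a walk: whenever a vertex recurs, the loop at it is cut
    out, which removes steps but creates none. (By contrast, the steps of an
    arbitrary subsequence of vertices need not be steps of the walk.) *)
Lemma loop_erasure {S : eqType} (f : T -> T -> S) (e : rel T) x p :
  path e x p ->
  exists q, [/\ path e x q, uniq (x :: q), last x q = last x p
              & subseq (pairmap f x q) (pairmap f x p)].
Proof.
elim: p x => [|y p IHp] x /=; first by exists [::].
case/andP=> exy /IHp[q [qpath quniq qlast qsub]].
have [xq|xq] := boolP (x \in y :: q); last first.
  exists (y :: q); rewrite /= exy qpath qlast eqxx qsub; split=> //.
  by move: quniq xq => /= -> ->.
case/splitPl: q / xq qpath quniq qlast qsub => q1 q2 last_q1.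
rewrite cat_path pairmap_cat last_cat last_q1 -cat_cons cat_uniq => /andP[_ q2path].
move=> /and3P[_ q1q2 q2uniq] q2last q2sub; exists q2; split=> //=.
  rewrite q2uniq andbT; apply: contra q1q2 => xq2; apply/hasP; exists x => //.
  by rewrite -last_q1 mem_last.
apply: subseq_trans (subseq_cons _ _).
exact: subseq_trans (suffix_subseq _ _) q2sub.
Qed.

End Walks.

Section Graphs.
Context {G : graph}.
Local Notation V := (vertex G).

Lemma adjacent_sym : symmetric (@Defs.adjacent G).
Proof. by move=> x y; rewrite /Defs.adjacent setUC. Qed.

Lemma walk_rev (x : V) p : path (@Defs.adjacent G) x p ->
  path (@Defs.adjacent G) (last x p) (rev (belast x p)).
Proof.
move=> xp; rewrite rev_path (eq_path (e' := @Defs.adjacent G))// => y z.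
by rewrite adjacent_sym.
Qed.

Lemma paths_rev (u v : V) p : paths u v p -> paths v u (rev (belast u p)).
Proof.
case=> up p_uniq <-; split; [exact: walk_rev| |exact: last_rev_belast].
by rewrite -rev_rcons -lastI rev_uniq.
Qed.

Lemma paths_self (u : V) p : paths u u p -> p = [::].
Proof.
case=> _ + p_last; case: p p_last => //= x p <-.
by rewrite mem_last.
Qed.

(** Unlike [graph_connected], this covers equal ends, joined by the path
    without edges. *)
Lemma connected_paths : graph_connected G -> forall u v : V, paths u v !=set0.
Proof.
by move=> conn u v; have [->|/conn//] := eqVneq u v; exists [::].
Qed.

Lemma walk_paths (u : V) p : path (@Defs.adjacent G) u p ->
  paths u (last u p) !=set0.
Proof.
by move=> /(loop_erasure (fun=> id) _ _ _)[q [? ? ? _]]; exists q.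
Qed.

End Graphs.

(** * The infimum of the path weights *)

Section PathWeight.
Context {R : realType} {Phi : R -> R -> R} {G : graph}.
Context {w : set (vertex G) -> R}.
Hypotheses (hPhi : triangle_function Phi) (hw : is_weight w).
Local Notation V := (vertex G).
Local Notation steps := (pairmap (fun x y : V => w [set x; y])).
Local Notation weights u v := [set path_weight Phi w u p | p in paths u v].

Lemma steps_ge0 (u : V) p : path (@Defs.adjacent G) u p ->
  {in steps u p, forall r, 0 <= r}.
Proof.
elim: p u => [//|x p IHp] u /= /andP[/asboolP ux /IHp p_ge0] r.
by rewrite in_cons => /orP[/eqP->|/p_ge0//]; exact: hw.
Qed.

Lemma path_weight_ge0 (u : V) p : path (@Defs.adjacent G) u p ->
  0 <= path_weight Phi w u p.
Proof. by move=> /steps_ge0; exact: phistar_ge0. Qed.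

Lemma weights_ge0 (u v : V) : lbound (weights u v) 0.
Proof. by move=> _ [p [up _ _] <-]; exact: path_weight_ge0. Qed.

Lemma dPhi_le (u v : V) p : paths u v p ->
  dPhi Phi w u v <= path_weight Phi w u p.
Proof.
by move=> uvp; apply: ge_inf; [exists 0; exact: weights_ge0|exists p].
Qed.

Lemma dPhi_self (u : V) : dPhi Phi w u u = 0.
Proof.
rewrite /dPhi (_ : weights u u = [set 0]) ?inf1//.
apply/seteqP; split=> [_ [p /paths_self-> <-]//|_ ->].
by exists [::].
Qed.

Lemma dPhi_sym : multiset_subadditive Phi ->
  forall u v : V, dPhi Phi w u v = dPhi Phi w v u.
Proof.
move=> subPhi u v; rewrite /dPhi; congr inf.
suff sub_rev x y : weights x y `<=` weights y x by apply/seteqP; split.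
move=> _ [p xyp <-]; exists (rev (belast x p)); first exact: paths_rev.
case: xyp => xp _ <-; rewrite /path_weight pairmap_rev; last first.
  by move=> a b; rewrite setUC.
apply: (phistar_perm subPhi); last by rewrite perm_rev.
by move=> r; rewrite mem_rev; exact: steps_ge0.
Qed.

(** Erase the loops of the walk that follows p from x to z and then q backwards
    to y; what remains uses each step at most as often as p and q together. *)
Lemma path_join : multiset_subadditive Phi ->
  forall (x y z : V) p q, paths x z p -> paths y z q ->
  exists2 r, paths x y r &
    path_weight Phi w x r <=
      Phi (path_weight Phi w x p) (path_weight Phi w y q).
Proof.
move=> subPhi x y z p q [xp _ p_last] [yq _ q_last].
have xyw : path (@Defs.adjacent G) x (p ++ rev (belast y q)).
  by rewrite cat_path xp p_last -q_last walk_rev.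
have [r [xr r_uniq]] := loop_erasure (fun x y => w [set x; y]) _ _ _ xyw.
rewrite last_cat pairmap_cat p_last -q_last last_rev_belast pairmap_rev; last first.
  by move=> a b; rewrite setUC.
move=> r_last r_sub; exists r; first by [].
apply: (phistar_subadd hPhi subPhi); try exact: steps_ge0.
move=> a; apply: leq_trans (leq_count_subseq _ r_sub) _.
by rewrite !count_cat count_rev.
Qed.

Lemma metrization_le_walk d : metrizations Phi w d ->
  forall (u : V) p, path (@Defs.adjacent G) u p ->
  d u (last u p) <= path_weight Phi w u p.
Proof.
move=> [[psm_d tri_d] w_d] u p; elim: p u => [|x p IHp] u.
  by rewrite /= (psm_refl psm_d).
move=> /= /andP[/asboolP ux xp]; rewrite /path_weight [pairmap _ _ _]/=.
have [->|pN] := eqVneq p [::]; first by rewrite /= w_d.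
rewrite phistar_cons; last by case: p pN {IHp xp}.
apply: le_trans (tri_d _ _ x) _; rewrite (psm_sym psm_d (last x p)).
by apply: (triangle_mono hPhi); rewrite ?(psm_ge0 psm_d)// ?w_d//; exact: IHp.
Qed.

Lemma metrization_le_dPhi d : graph_connected G -> metrizations Phi w d ->
  psm_le d (dPhi Phi w).
Proof.
move=> conn dM u v; apply: lb_le_inf.
  by have [p uvp] := connected_paths conn u v; exists (path_weight Phi w u p); exists p.
by move=> _ [p [up _ <-] <-]; exact: metrization_le_walk.
Qed.

Lemma dPhi_metrization : multiset_subadditive Phi -> continuous_nneg2 Phi ->
  graph_connected G -> pseudosemimetrizable Phi w ->
  metrizations Phi w (dPhi Phi w).
Proof.
move=> subPhi contPhi conn [d dM].
have weights_neq0 (u v : V) : weights u v !=set0.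
  by have [p uvp] := connected_paths conn u v; exists (path_weight Phi w u p); exists p.
split; [split; [split|]|].
- by move=> u v; apply: lb_le_inf => //; exact: weights_ge0.
- exact: dPhi_self.
- exact: dPhi_sym.
- move=> x y z; apply: (Phi_inf_ge contPhi) => //; try exact: weights_ge0.
  move=> _ _ [p xzp <-] [q yzq <-].
  have [r xyr] := path_join subPhi _ _ _ _ _ xzp yzq.
  exact: le_trans (dPhi_le _ _ _ xyr).
- move=> u v uv; have [[psm_d _] w_d] := dM.
  have [uv_eq|uNv] := eqVneq u v.
    by rewrite w_d// uv_eq (psm_refl psm_d) dPhi_self.
  apply/eqP; rewrite eq_le {1}w_d// metrization_le_dPhi//=.
  apply: (dPhi_le _ _ [:: v]); split=> //=.
    by rewrite andbT; apply/asboolP.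
  by rewrite inE uNv.
Qed.

End PathWeight.

(** * Linking two sides by a virtual edge *)

Section Bridge.
Context {R : realType} {Phi : R -> R -> R} {X : Type}.
Hypotheses (hPhi : triangle_function Phi) (hPhi1 : cyclic_assoc Phi).
Hypothesis hPhi3 : dominates_max Phi.

(** The distance after adding an edge of length k from u to v as the only link
    between the side C of u and its complement. *)
Definition bridge (d : X -> X -> R) (C : pred X) (u v : X) (k : R) (x y : X) : R :=
  let r x := d x (if C x then u else v) in
  if C x == C y then d x y else Phi (r x) (Phi k (r y)).

(** In the triangle inequality for x, y and z, if x and y are on the same side
    and z is across, the crossing distances to z already dominate the distances
    of x and y to the end of the edge on their side. If x and y are on opposite
    sides, z shares a side with one of them, say x; the triangle inequality for
    x, z and their end of the edge then carries over to the crossing distances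
    by associativity and monotonicity. *)
Lemma Phi_pseudosemimetric_bridge d C u v k : 0 <= k ->
  Phi_pseudosemimetric Phi d -> Phi_pseudosemimetric Phi (bridge d C u v k).
Proof.
move=> k0 [psm_d tri_d]; pose r x := d x (if C x then u else v).
pose cross x y := Phi (r x) (Phi k (r y)).
have bridgeE x y : bridge d C u v k x y = if C x == C y then d x y else cross x y.
  by [].
have r0 x : 0 <= r x by exact: (psm_ge0 psm_d).
have d0 x y : 0 <= d x y by exact: (psm_ge0 psm_d).
have Phi0 x y : 0 <= x -> 0 <= y -> 0 <= Phi x y by exact: (triangle_ge0 hPhi).
have cross0 x y : 0 <= cross x y by rewrite /cross !Phi0.
have cross_sym x y : cross x y = cross y x.
  by rewrite /cross hPhi1// [Phi (r x) k](triangle_sym hPhi).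
have r_cross x y : r x <= cross x y by rewrite (le_Phil hPhi3)// Phi0.
have d_r x y : C x = C y -> d x y <= Phi (r x) (r y).
  by move=> Cxy; rewrite /r Cxy; exact: tri_d.
have cross_tri x y z : C x = C z -> cross x y <= Phi (d x z) (cross z y).
  move=> Cxz; rewrite /cross [Phi (d x z) _](Phi_assoc hPhi hPhi1)// ?Phi0//.
  apply: (triangle_mono hPhi) => //; first by rewrite Phi0.
  by rewrite /r Cxz (psm_sym psm_d z); apply: tri_d.
split; first split.
- by move=> x y; rewrite bridgeE; case: ifP.
- by move=> x; rewrite bridgeE eqxx (psm_refl psm_d).
- by move=> x y; rewrite !bridgeE eq_sym (psm_sym psm_d) cross_sym.
move=> x y z; rewrite !bridgeE.
have [Cxy|Cxy] := eqVneq (C x) (C y).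
  rewrite -Cxy; case: ifP => // _; apply: le_trans (d_r _ _ Cxy) _.
  exact: (triangle_mono hPhi).
have [Cxz|Cxz] := eqVneq (C x) (C z).
  by rewrite -Cxz eq_sym (negbTE Cxy) (cross_sym y z); exact: cross_tri.
have Cyz : C y = C z by move: Cxy Cxz; case: (C x) (C y) (C z) => [] [] [].
rewrite Cyz eqxx (triangle_sym hPhi)// (cross_sym x y) (cross_sym x z).
exact: cross_tri.
Qed.

Lemma bridge_same d C u v k x y : C x = C y -> bridge d C u v k x y = d x y.
Proof. by rewrite /bridge => ->; rewrite eqxx. Qed.

Lemma bridge_ends d (C : pred X) u v k : 0 <= k -> Phi_pseudosemimetric Phi d ->
  C u -> ~~ C v -> k <= bridge d C u v k u v.
Proof.
move=> k0 [psm_d _] Cu Cv; rewrite /bridge Cu (negbTE Cv)/= !(psm_refl psm_d).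
apply: le_trans (le_Phil hPhi3 k 0 k0 _) _ => //.
by apply: (le_Phir hPhi3) => //; apply: (triangle_ge0 hPhi).
Qed.

End Bridge.

Section Converse.
Context {R : realType} {Phi : R -> R -> R} {G : graph}.
Context {w : set (vertex G) -> R}.
Hypotheses (hPhi : triangle_function Phi) (hPhi1 : cyclic_assoc Phi).
Hypothesis hPhi3 : dominates_max Phi.

Lemma bridge_metrization d (C : pred (vertex G)) u v k : 0 <= k ->
  (forall x y, edge [set x; y] -> C x = C y) ->
  metrizations Phi w d -> metrizations Phi w (bridge (Phi := Phi) d C u v k).
Proof.
move=> k0 C_edge [dPhi w_d]; split; first exact: Phi_pseudosemimetric_bridge.
by move=> x y xy; rewrite bridge_same ?w_d//; exact: C_edge.
Qed.

(** If u and v are not joined by a path, a metrization bridged between the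
    component of u and its complement by an edge longer than the alleged
    greatest distance D u v gives a contradiction. *)
Lemma greatest_connected : (exists D, is_greatest (metrizations Phi w) D) ->
  graph_connected G.
Proof.
move=> [D [DM D_max]] u v _; have [//|no_path] := pselect (paths u v !=set0).
pose C : pred (vertex G) :=
  fun x => `[< exists2 p, path (@Defs.adjacent G) u p & last u p = x >].
have C_adj x y : edge [set x; y] -> C x -> C y.
  move=> xy /asboolP[p up p_last]; apply/asboolP; exists (rcons p y).
    by rewrite rcons_path up p_last; apply/asboolP.
  by rewrite last_rcons.
have C_edge x y : edge [set x; y] -> C x = C y.
  by move=> xy; apply/idP/idP; apply: C_adj => //; rewrite setUC.
have Cu : C u by apply/asboolP; exists [::].
have Cv : ~~ C v.
  apply/asboolP => -[p up p_last]; apply: no_path.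
  by rewrite -p_last; exact: walk_paths.
have k0 : 0 <= D u v + 1.
  by rewrite addr_ge0//; case: DM => -[psm_D _] _; exact: (psm_ge0 psm_D).
have := D_max _ (bridge_metrization _ _ u v _ k0 C_edge DM) u v.
move=> /(le_trans (bridge_ends hPhi hPhi3 _ _ _ _ _ k0 (proj1 DM) Cu Cv)).
by rewrite gerDl ler10.
Qed.

End Converse.

Theorem corollary4p2 (R : realType) (Phi : R -> R -> R)
    (hPhi : triangle_function Phi)
    (hPhi1 : cyclic_assoc Phi) (hPhi2 : multiset_subadditive Phi) (hPhi3 : dominates_max Phi)
    (hPhic : continuous_nneg2 Phi)
    (G : graph) (w : set (vertex G) -> R) (hw : is_weight w)
    (hmet : pseudosemimetrizable Phi w) :
  (graph_connected G -> is_greatest (metrizations Phi w) (dPhi Phi w)) /\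
  ((exists d, is_greatest (metrizations Phi w) d) -> graph_connected G).
Proof.
split=> [conn|]; last exact: greatest_connected.
split=> [|d dM]; first exact: dPhi_metrization.
exact: metrization_le_dPhi.
Qed.
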